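(* Let $q\in\mathbb{C}^*$ be not a root of unity and $\alpha,\beta\in\mathbb{C}$. Each of the six pairs $$(1\otimes\widehat{A},\Delta(\widehat{A})),\quad(\widehat{A}\otimes1,\overline{\Delta}(\widehat{A})),\quad(1\otimes\widehat{B},\Delta(\widehat{B})),\quad(\widehat{B}\otimes1,\overline{\Delta}(\widehat{B})),\quad(\widehat{A}\otimes1,1\otimes\widehat{B}),\quad(\widehat{B}\otimes1,1\otimes\widehat{A})$$ generates a commutative subalgebra of $\mathcal{L}U_qsl_2\otimes\mathcal{L}U_qsl_2$ (i.e. the two elements of each pair commute).
   Context: $[X,Y]_q=qXY-q^{-1}YX$ and $[X,Y]=XY-YX$. The quantum loop algebra $\mathcal{L}U_qsl_2$ is the unital associative $\mathbb{C}$-algebra generated by $e_i,f_i,k_i^{\pm1}$, $i\in\{0,1\}$, with relations (where $a_{ii}=2$, $a_{ij}=-2$ for $i\ne j$): $k_ie_j=q^{a_{ij}/2}e_jk_i$, $k_if_j=q^{-a_{ij}/2}f_jk_i$, $[e_i,f_j]=\delta_{i,j}\frac{k_i^2-k_i^{-2}}{q-q^{-1}}$, $k_ik_i^{-1}=k_i^{-1}k_i=1$, $k_0k_1=k_1k_0=1$, and for $i\neq j$: $[e_i,[e_i,[e_i,e_j]_q]_{q^{-1}}]=0$, $[f_i,[f_i,[f_i,f_j]_q]_{q^{-1}}]=0$. The coproduct $\Delta$ is the algebra homomorphism with $\Delta(e_i)=e_i\otimes k_i^{-1}+k_i\otimes e_i$, $\Delta(f_i)=f_i\otimes k_i^{-1}+k_i\otimes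 f_i$, $\Delta(k_i^{\pm1})=k_i^{\pm1}\otimes k_i^{\pm1}$; $\overline{\Delta}=\sigma\circ\Delta$ with $\sigma(x\otimes y)=y\otimes x$. $\widehat{A}=(q-q^{-1})(e_1k_1-f_1k_1)+\alpha k_1^2$, $\widehat{B}=(q-q^{-1})(f_0k_0-e_0k_0)+\beta k_0^2$. *)

(* Defs.v *)
From HB Require Import structures.
From mathcomp Require Import all_boot all_order all_algebra.
From mathcomp Require Import boolp finmap monalg.

Set Implicit Arguments.
Unset Strict Implicit.
Unset Printing Implicit Defensive.

Import GRing.Theory.
Local Open Scope ring_scope.

Lemma malgUZ (K : fieldType) (X : choiceType) (c : K) (x : X) :
  << c *g x >> = c *: << x >>.
Proof. by apply/malgP => y; rewrite mcoeffZ !mcoeffU mulrnAr mulr1. Qed.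

Lemma malg_scalerAr (K : fieldType) (M : monomType) (c : K)
  (u v : {malg K[M]}) : c *: (u * v) = u * (c *: v).
Proof.
have cC : c%:MP * u = u * c%:MP.
  rewrite !malgM_def fgmulUg fgmulgU; apply: eq_bigr => m _.
  by rewrite mul1m mulm1 mulrC.
by rewrite -[LHS]mul_malgC -[c *: v]mul_malgC !mulrA cC.
Qed.

(* Distinct locks keep the unifier from unfolding the quotient constructions *)
Fact pres_mul_key : unit. Proof. by []. Qed.
Fact pres_scale_key : unit. Proof. by []. Qed.
Fact LU_e_key : unit. Proof. by []. Qed.
Fact LU_f_key : unit. Proof. by []. Qed.
Fact LU_k_key : unit. Proof. by []. Qed.
Fact LU_kV_key : unit. Proof. by []. Qed.
Fact tens_key : unit. Proof. by []. Qed.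
Fact tens_scale_key : unit. Proof. by []. Qed.
Fact tens_mul_key : unit. Proof. by []. Qed.

Section FreeModule.
Variables (K : fieldType) (X : choiceType) (V : lmodType K) (h : X -> V).

Definition free_lift (g : {malg K[X]}) : V := \sum_(x <- msupp g) g@_x *: h x.

Lemma free_liftEw (d : {fset X}) g : (msupp g `<=` d)%fset ->
  free_lift g = \sum_(x <- d) g@_x *: h x.
Proof.
move=> le; rewrite [LHS](big_fset_incl _ le) => //= x xd /mcoeff_outdom ->.
by rewrite scale0r.
Qed.

Lemma free_liftU x : free_lift << x >> = h x.
Proof. by rewrite (free_liftEw msuppU_le) big_seq_fset1 mcoeffUU scale1r. Qed.

Lemma free_lift_linear : linear free_lift.
Proof.
move=> a u v.
have le1 : (msupp (a *: u + v) `<=` msupp u `|` msupp v)%fset.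
  by apply: fsubset_trans (msuppD_le _ _) _; apply: fsetSU; apply: msuppZ_le.
rewrite (free_liftEw le1) (free_liftEw (fsubsetUl _ (msupp v))).
rewrite (free_liftEw (fsubsetUr (msupp u) _)) scaler_sumr -big_split /=.
by apply: eq_bigr => x _; rewrite mcoeffD mcoeffZ scalerDl scalerA.
Qed.

HB.instance Definition _ :=
  GRing.isLinear.Build K {malg K[X]} V *:%R free_lift free_lift_linear.

End FreeModule.

Section FreeAlgebra.
Variables (K : fieldType) (X : choiceType) (B : algType K) (h : X -> B).
Local Notation F := {malg K[{fmonom X}]}.

Definition word_eval (m : {fmonom X}) : B := \prod_(x <- (m : seq X)) h x.

Definition free_eval (g : F) : B := free_lift word_eval g.

HB.instance Definition _ :=
  GRing.isLinear.Build K F B *:%R free_eval (free_lift_linear word_eval).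

Lemma word_evalM m1 m2 : word_eval (mmul m1 m2) = word_eval m1 * word_eval m2.
Proof. by rewrite /word_eval fmM big_cat. Qed.

Lemma free_eval1 : free_eval 1 = 1.
Proof. by rewrite /free_eval free_liftU /word_eval fm1 big_nil. Qed.

Lemma free_evalU x : free_eval << fmu x >> = h x.
Proof. by rewrite /free_eval free_liftU /word_eval fmU big_seq1. Qed.

Lemma free_evalM u v : free_eval (u * v) = free_eval u * free_eval v.
Proof.
rewrite malgME linear_sum /= [in RHS]/free_eval /free_lift mulr_suml.
apply: eq_bigr => m _; rewrite linear_sum mulr_sumr; apply: eq_bigr => n _ /=.
rewrite malgUZ linearZ /= /free_eval free_liftU word_evalM.
by rewrite -scalerAl -scalerAr scalerA.
Qed.

HB.instance Definition _ := GRing.isMonoidMorphism.Build F B free_eval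
  (free_eval1, free_evalM).

End FreeAlgebra.

(* The K-algebra on the generators X subject to the relations r = 0 for the
   relators r in rel: the free algebra modulo the two-sided ideal they span *)
Section Presentation.
Variables (K : fieldType) (X : choiceType).
Local Notation F := {malg K[{fmonom X}]}.
Variable rel : F -> Prop.

Inductive ideal_span : F -> Prop :=
| ideal_span0 : ideal_span 0
| ideal_span_rel r : rel r -> ideal_span r
| ideal_spanD u v : ideal_span u -> ideal_span v -> ideal_span (u + v)
| ideal_spanM a u b : ideal_span u -> ideal_span (a * u * b).

Definition ideal_pred : {pred F} := fun u => `[< ideal_span u >].

Lemma ideal_zmod_closed : zmod_closed ideal_pred.
Proof.
split=> [|u v /asboolP hu /asboolP hv]; apply/asboolP; first exact: ideal_span0.
by apply: ideal_spanD => //; rewrite -mulN1r -[_ * v]mulr1; apply: ideal_spanM.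
Qed.

HB.instance Definition _ := GRing.isZmodClosed.Build F ideal_pred
  ideal_zmod_closed.

Definition presented := Quotient.quot ideal_pred.

HB.instance Definition _ := Choice.on presented.
HB.instance Definition _ := GRing.Zmodule.on presented.

Definition pres_pi (u : F) : presented := (\pi_(Quotient.quot ideal_pred) u)%qT.
Definition pres_repr (x : presented) : F :=
  repr (x : Quotient.quot ideal_pred).

Lemma pres_reprK x : pres_pi (pres_repr x) = x.
Proof. exact: reprK. Qed.

Lemma pres_piP u v : pres_pi u = pres_pi v <-> ideal_span (u - v).
Proof.
split=> [/eqP|h]; first by rewrite -Quotient.idealrBE => /asboolP.
by apply/eqP; rewrite -Quotient.idealrBE; apply/asboolP.
Qed.

Lemma pres_piD : {morph pres_pi : u v / u + v}.
Proof. by move=> u v; rewrite /pres_pi Quotient.pi_add. Qed.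

Definition pres_one : presented := pres_pi 1.
Definition pres_mul : presented -> presented -> presented :=
  locked_with pres_mul_key (fun x y => pres_pi (pres_repr x * pres_repr y)).
Definition pres_scale : K -> presented -> presented :=
  locked_with pres_scale_key (fun a x => pres_pi (a *: pres_repr x)).

Lemma pres_repr_pi u : ideal_span (pres_repr (pres_pi u) - u).
Proof. by apply/pres_piP; rewrite pres_reprK. Qed.

Lemma ideal_spanMl a u : ideal_span u -> ideal_span (a * u).
Proof. by move=> h; rewrite -[_ * _]mulr1; apply: ideal_spanM. Qed.
Lemma ideal_spanMr u b : ideal_span u -> ideal_span (u * b).
Proof. by move=> h; rewrite -[u]mul1r; apply: ideal_spanM. Qed.

Lemma pres_piM u v : pres_mul (pres_pi u) (pres_pi v) = pres_pi (u * v).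
Proof.
rewrite /pres_mul unlock; apply/pres_piP; set u' := pres_repr _; set v' := pres_repr _.
have -> : u' * v' - u * v = u' * (v' - v) + (u' - u) * v.
  by rewrite mulrBl mulrBr addrA subrK.
apply: ideal_spanD; first exact/ideal_spanMl/pres_repr_pi.
exact/ideal_spanMr/pres_repr_pi.
Qed.

Lemma pres_piZ a u : pres_scale a (pres_pi u) = pres_pi (a *: u).
Proof.
rewrite /pres_scale unlock; apply/pres_piP.
by rewrite -scalerBr -mul_malgC; apply/ideal_spanMl/pres_repr_pi.
Qed.

Fact pres_mulA : associative pres_mul.
Proof.
move=> x y z; rewrite -[x]pres_reprK -[y]pres_reprK -[z]pres_reprK.
by rewrite !pres_piM mulrA.
Qed.
Fact pres_mul1x : left_id pres_one pres_mul.
Proof. by move=> x; rewrite -[x]pres_reprK pres_piM mul1r. Qed.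
Fact pres_mulx1 : right_id pres_one pres_mul.
Proof. by move=> x; rewrite -[x]pres_reprK pres_piM mulr1. Qed.
Fact pres_mulDl : left_distributive pres_mul +%R.
Proof.
move=> x y z; rewrite -[x]pres_reprK -[y]pres_reprK -[z]pres_reprK.
by rewrite -pres_piD !pres_piM mulrDl pres_piD.
Qed.
Fact pres_mulDr : right_distributive pres_mul +%R.
Proof.
move=> x y z; rewrite -[x]pres_reprK -[y]pres_reprK -[z]pres_reprK.
by rewrite -pres_piD !pres_piM mulrDr pres_piD.
Qed.
HB.instance Definition _ := GRing.Zmodule_isPzRing.Build presented
  pres_mulA pres_mul1x pres_mulx1 pres_mulDl pres_mulDr.

Fact pres_scaleA a b x : pres_scale a (pres_scale b x) = pres_scale (a * b) x.
Proof. by rewrite -[x]pres_reprK !pres_piZ scalerA. Qed.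
Fact pres_scale1 : left_id 1 pres_scale.
Proof. by move=> x; rewrite -[x]pres_reprK pres_piZ scale1r. Qed.
Fact pres_scaleDr : right_distributive pres_scale +%R.
Proof.
move=> a x y; rewrite -[x]pres_reprK -[y]pres_reprK.
by rewrite -pres_piD !pres_piZ scalerDr pres_piD.
Qed.
Fact pres_scaleDl x : {morph pres_scale^~ x : a b / a + b}.
Proof.
move=> a b; rewrite -[x]pres_reprK.
by rewrite !pres_piZ scalerDl pres_piD.
Qed.
HB.instance Definition _ := GRing.Zmodule_isLmodule.Build K presented
  pres_scaleA pres_scale1 pres_scaleDr pres_scaleDl.

Fact pres_pi_linear : linear pres_pi.
Proof. by move=> a u v; rewrite pres_piD -pres_piZ. Qed.
HB.instance Definition _ :=
  GRing.isLinear.Build K F presented *:%R pres_pi pres_pi_linear.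
Fact pres_pi_monoid : monoid_morphism pres_pi.
Proof. by split=> [|u v]; [exact: erefl | exact: esym (pres_piM u v)]. Qed.
HB.instance Definition _ :=
  GRing.isMonoidMorphism.Build F presented pres_pi pres_pi_monoid.

Fact pres_scaleAl (a : K) (x y : presented) : a *: (x * y) = (a *: x) * y.
Proof.
rewrite -[x]pres_reprK -[y]pres_reprK.
by rewrite -rmorphM -!linearZ -rmorphM /= scalerAl.
Qed.
Fact pres_scaleAr (a : K) (x y : presented) : a *: (x * y) = x * (a *: y).
Proof.
rewrite -[x]pres_reprK -[y]pres_reprK.
rewrite -rmorphM -!linearZ -rmorphM /=.
by congr pres_pi; apply: malg_scalerAr.
Qed.

Section Lift.
Variables (B : algType K) (h : X -> B).
Hypothesis h_rel : forall r, rel r -> free_eval h r = 0.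

Definition pres_lift of (forall r, rel r -> free_eval h r = 0) :=
  fun x : presented => free_eval h (pres_repr x).
Local Notation lift := (pres_lift h_rel).

Lemma free_eval_ideal u : ideal_span u -> free_eval h u = 0.
Proof.
elim=> [|r /h_rel //|{}u v _ hu _ hv|a {}u b _ hu].
- exact: linear0.
- by rewrite linearD /= hu hv addr0.
- by rewrite !rmorphM /= hu mulr0 mul0r.
Qed.

Lemma pres_lift_pi u : lift (pres_pi u) = free_eval h u.
Proof.
apply/eqP; rewrite -subr_eq0 -linearB /=.
by apply/eqP/free_eval_ideal/pres_repr_pi.
Qed.

Fact pres_lift_linear : linear lift.
Proof.
move=> a x y; rewrite -[x]pres_reprK -[y]pres_reprK.
by rewrite -linearP !pres_lift_pi linearP.
Qed.
HB.instance Definition _ :=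
  GRing.isLinear.Build K presented B *:%R lift pres_lift_linear.

Fact pres_lift_monoid : monoid_morphism lift.
Proof.
split=> [|x y]; first by rewrite -(rmorph1 pres_pi) pres_lift_pi rmorph1.
rewrite -[x]pres_reprK -[y]pres_reprK.
by rewrite -rmorphM !pres_lift_pi rmorphM.
Qed.
HB.instance Definition _ :=
  GRing.isMonoidMorphism.Build presented B lift pres_lift_monoid.

End Lift.
End Presentation.

(* The free vector space on A * B modulo the bilinearity relations *)
Section Tensor.
Variables (K : fieldType) (A B : algType K).
Local Notation F := {malg K[(A * B)%type]}.

Definition pure (a : A) (b : B) : F := << (a, b) >>.

Inductive bilin_span : F -> Prop :=
| bilin_spanl c a a' b :
    bilin_span (pure (c *: a + a') b - (c *: pure a b + pure a' b))
| bilin_spanr c a b b' :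
    bilin_span (pure a (c *: b + b') - (c *: pure a b + pure a b'))
| bilin_span0 : bilin_span 0
| bilin_spanD c u v : bilin_span u -> bilin_span v -> bilin_span (c *: u + v).

Definition bilin_pred : {pred F} := fun u => `[< bilin_span u >].

Lemma bilin_spanZ c u : bilin_span u -> bilin_span (c *: u).
Proof.
by move=> h; rewrite -[_ *: _]addr0; apply: bilin_spanD h bilin_span0.
Qed.

Lemma bilin_zmod_closed : zmod_closed bilin_pred.
Proof.
split=> [|u v /asboolP hu /asboolP hv]; apply/asboolP; first exact: bilin_span0.
by rewrite addrC -scaleN1r; apply: bilin_spanD.
Qed.

HB.instance Definition _ := GRing.isZmodClosed.Build F bilin_pred
  bilin_zmod_closed.

Definition tensor := Quotient.quot bilin_pred.

HB.instance Definition _ := Choice.on tensor.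
HB.instance Definition _ := GRing.Zmodule.on tensor.

Definition tens_pi (u : F) : tensor := (\pi_(Quotient.quot bilin_pred) u)%qT.
Definition tens_repr (x : tensor) : F := repr (x : Quotient.quot bilin_pred).

Lemma tens_reprK x : tens_pi (tens_repr x) = x.
Proof. exact: reprK. Qed.

Lemma tens_piP u v : tens_pi u = tens_pi v <-> bilin_span (u - v).
Proof.
split=> [/eqP|h]; first by rewrite -Quotient.idealrBE => /asboolP.
by apply/eqP; rewrite -Quotient.idealrBE; apply/asboolP.
Qed.

Lemma tens_piD : {morph tens_pi : u v / u + v}.
Proof. by move=> u v; rewrite /tens_pi Quotient.pi_add. Qed.

Lemma tens_repr_pi u : bilin_span (tens_repr (tens_pi u) - u).
Proof. by apply/tens_piP; rewrite tens_reprK. Qed.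

Definition tens_scale : K -> tensor -> tensor :=
  locked_with tens_scale_key (fun a x => tens_pi (a *: tens_repr x)).

Lemma tens_piZ a u : tens_scale a (tens_pi u) = tens_pi (a *: u).
Proof.
rewrite /tens_scale unlock; apply/tens_piP.
by rewrite -scalerBr; apply/bilin_spanZ/tens_repr_pi.
Qed.

Fact tens_scaleA a b x : tens_scale a (tens_scale b x) = tens_scale (a * b) x.
Proof. by rewrite -[x]tens_reprK !tens_piZ scalerA. Qed.
Fact tens_scale1 : left_id 1 tens_scale.
Proof. by move=> x; rewrite -[x]tens_reprK tens_piZ scale1r. Qed.
Fact tens_scaleDr : right_distributive tens_scale +%R.
Proof.
move=> a x y; rewrite -[x]tens_reprK -[y]tens_reprK.
by rewrite -tens_piD !tens_piZ scalerDr tens_piD.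
Qed.
Fact tens_scaleDl x : {morph tens_scale^~ x : a b / a + b}.
Proof.
move=> a b; rewrite -[x]tens_reprK.
by rewrite !tens_piZ scalerDl tens_piD.
Qed.
HB.instance Definition _ := GRing.Zmodule_isLmodule.Build K tensor
  tens_scaleA tens_scale1 tens_scaleDr tens_scaleDl.

Fact tens_pi_linear : linear tens_pi.
Proof. by move=> a u v; rewrite tens_piD -tens_piZ. Qed.
HB.instance Definition _ :=
  GRing.isLinear.Build K F tensor *:%R tens_pi tens_pi_linear.

Definition tens : A -> B -> tensor :=
  locked_with tens_key (fun a b => tens_pi (pure a b)).
Lemma tensE a b : tens a b = tens_pi (pure a b).
Proof. by rewrite /tens unlock. Qed.
Local Notation "a ⊗ b" := (tens a b) (at level 40, left associativity).

Lemma tensPl c a a' b : (c *: a + a') ⊗ b = c *: (a ⊗ b) + a' ⊗ b.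
Proof. by rewrite !tensE -linearP; apply/tens_piP; apply: bilin_spanl. Qed.
Lemma tensPr c a b b' : a ⊗ (c *: b + b') = c *: (a ⊗ b) + a ⊗ b'.
Proof. by rewrite !tensE -linearP; apply/tens_piP; apply: bilin_spanr. Qed.

Section Lift.
Variables (V : lmodType K) (f : A -> B -> V).

Definition bilinear2 : Prop := (forall b, linear (f^~ b)) /\ (forall a, linear (f a)).

Definition tens_lift (x : tensor) : V :=
  free_lift (fun p => f p.1 p.2) (tens_repr x).

Hypothesis f_bilin : bilinear2.

Lemma free_lift_bilin u :
  bilin_span u -> free_lift (fun p => f p.1 p.2) u = 0.
Proof.
elim=> [c a a' b|c a b b'||c {}u v _ hu _ hv].
- by rewrite linearB linearP /= !free_liftU /= (f_bilin.1 b) subrr.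
- by rewrite linearB linearP /= !free_liftU /= (f_bilin.2 a) subrr.
- exact: linear0.
- by rewrite linearP /= hu hv scaler0 addr0.
Qed.

Lemma tens_lift_pi u :
  tens_lift (tens_pi u) = free_lift (fun p => f p.1 p.2) u.
Proof.
apply/eqP; rewrite -subr_eq0 -linearB /=.
by apply/eqP/free_lift_bilin/tens_repr_pi.
Qed.

Lemma tens_liftE a b : tens_lift (a ⊗ b) = f a b.
Proof. by rewrite tensE tens_lift_pi free_liftU. Qed.

Lemma tens_lift_linear : linear tens_lift.
Proof.
move=> a x y; rewrite -[x]tens_reprK -[y]tens_reprK.
by rewrite -linearP !tens_lift_pi linearP.
Qed.
End Lift.

Lemma tens_ind (P : tensor -> Prop) :
  (forall a b, P (a ⊗ b)) -> (forall c x y, P x -> P y -> P (c *: x + y)) ->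
  forall x, P x.
Proof.
move=> Pt PP x; rewrite -[x]tens_reprK [tens_repr x]monalgE.
have P0 : P 0.
  by rewrite -[0](addNr (0 ⊗ 0)) -scaleN1r; apply: PP; apply: Pt.
elim: (X in \sum_(k <- X) _) => [|[a b] s IH]; first by rewrite big_nil linear0.
by rewrite big_cons malgUZ linearP; apply: PP IH; move: (Pt a b); rewrite tensE.
Qed.

Definition pure_mul (a : A) (b : B) (y : tensor) : tensor :=
  tens_lift (fun a' b' => (a * a') ⊗ (b * b')) y.

Definition tens_mul : tensor -> tensor -> tensor :=
  locked_with tens_mul_key (fun x y => tens_lift (fun a b => pure_mul a b y) x).
Lemma tens_mul_unlock x y :
  tens_mul x y = tens_lift (fun a b => pure_mul a b y) x.
Proof. by rewrite /tens_mul unlock. Qed.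

Lemma bilin_mulr a b : bilinear2 (fun a' b' => (a * a') ⊗ (b * b')).
Proof.
by split=> [b'|a'] c u v; rewrite mulrDr -scalerAr ?tensPl ?tensPr.
Qed.

Lemma pure_mulE a b a' b' : pure_mul a b (a' ⊗ b') = (a * a') ⊗ (b * b').
Proof. exact: tens_liftE (bilin_mulr a b) a' b'. Qed.

Lemma pure_mulP a b c x y :
  pure_mul a b (c *: x + y) = c *: pure_mul a b x + pure_mul a b y.
Proof. exact: tens_lift_linear (bilin_mulr a b) c x y. Qed.

Lemma scaler_exchange (V : lmodType K) (c d : K) (x1 x2 y1 y2 : V) :
  d *: (c *: x1 + x2) + (c *: y1 + y2) = c *: (d *: x1 + y1) + (d *: x2 + y2).
Proof. by rewrite !scalerDr !scalerA addrACA [d * c]mulrC. Qed.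

Lemma bilin_mull y : bilinear2 (fun a b => pure_mul a b y).
Proof.
split=> [b|a] c u v; elim/tens_ind: y => [a' b'|d x y hx hy].
- by rewrite !pure_mulE mulrDl -scalerAl tensPl.
- rewrite (pure_mulP u b) (pure_mulP v b) (pure_mulP (c *: u + v) b) hx hy.
  exact: scaler_exchange.
- by rewrite !pure_mulE mulrDl -scalerAl tensPr.
- rewrite (pure_mulP a u) (pure_mulP a v) (pure_mulP a (c *: u + v)) hx hy.
  exact: scaler_exchange.
Qed.

Lemma tens_mulE a b a' b' : tens_mul (a ⊗ b) (a' ⊗ b') = (a * a') ⊗ (b * b').
Proof. by rewrite tens_mul_unlock (tens_liftE (bilin_mull _)) pure_mulE. Qed.

Lemma tens_mulPl c x y z :
  tens_mul (c *: x + y) z = c *: tens_mul x z + tens_mul y z.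
Proof. by rewrite !tens_mul_unlock (tens_lift_linear (bilin_mull z)). Qed.

Lemma tens_mulPr c x y z :
  tens_mul z (c *: x + y) = c *: tens_mul z x + tens_mul z y.
Proof.
elim/tens_ind: z => [a b|d z t hz ht].
  rewrite !tens_mul_unlock !(tens_liftE (bilin_mull _)).
  exact: pure_mulP.
rewrite (tens_mulPl d z t x) (tens_mulPl d z t y) tens_mulPl hz ht.
exact: scaler_exchange.
Qed.

Fact tens_mulA : associative tens_mul.
Proof.
move=> x y z; elim/tens_ind: x => [a b|c x x' hx hx']; last first.
  rewrite (tens_mulPl c x x' (tens_mul y z)) (tens_mulPl c x x' y) hx hx'.
  exact: esym (tens_mulPl c (tens_mul x y) (tens_mul x' y) z).
elim/tens_ind: y => [a' b'|c y y' hy hy']; last first.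
  rewrite (tens_mulPl c y y' z) (tens_mulPr c y y' (a ⊗ b)).
  rewrite (tens_mulPr c (tens_mul y z) (tens_mul y' z)) hy hy'.
  exact: esym (tens_mulPl c (tens_mul (a ⊗ b) y) (tens_mul (a ⊗ b) y') z).
elim/tens_ind: z => [a'' b''|c z z' hz hz'].
  by rewrite !tens_mulE !mulrA.
rewrite (tens_mulPr c z z' (a' ⊗ b')).
rewrite (tens_mulPr c (tens_mul (a' ⊗ b') z) (tens_mul (a' ⊗ b') z')) hz hz'.
exact: esym (tens_mulPr c z z' (tens_mul (a ⊗ b) (a' ⊗ b'))).
Qed.
Fact tens_mul1x : left_id (1 ⊗ 1) tens_mul.
Proof.
elim/tens_ind => [a b|c x y hx hy]; first by rewrite tens_mulE !mul1r.
by rewrite tens_mulPr hx hy.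
Qed.
Fact tens_mulx1 : right_id (1 ⊗ 1) tens_mul.
Proof.
elim/tens_ind => [a b|c x y hx hy]; first by rewrite tens_mulE !mulr1.
by rewrite tens_mulPl hx hy.
Qed.
Fact tens_mulDl : left_distributive tens_mul +%R.
Proof. by move=> x y z; rewrite -[x]scale1r tens_mulPl !scale1r. Qed.
Fact tens_mulDr : right_distributive tens_mul +%R.
Proof. by move=> x y z; rewrite -[y]scale1r tens_mulPr !scale1r. Qed.
HB.instance Definition _ := GRing.Zmodule_isPzRing.Build tensor
  tens_mulA tens_mul1x tens_mulx1 tens_mulDl tens_mulDr.

Lemma tensM a b a' b' : (a ⊗ b) * (a' ⊗ b') = (a * a') ⊗ (b * b').
Proof. exact: tens_mulE. Qed.

Lemma tens0l b : 0 ⊗ b = 0.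
Proof. by have := tensPl (-1) 0 0 b; rewrite scaler0 addr0 scaleN1r addNr. Qed.
Lemma tens0r a : a ⊗ 0 = 0.
Proof. by have := tensPr (-1) a 0 0; rewrite scaler0 addr0 scaleN1r addNr. Qed.
Lemma tensZl c a b : (c *: a) ⊗ b = c *: (a ⊗ b).
Proof. by rewrite -[c *: a]addr0 tensPl tens0l addr0. Qed.
Lemma tensZr c a b : a ⊗ (c *: b) = c *: (a ⊗ b).
Proof. by rewrite -[c *: b]addr0 tensPr tens0r addr0. Qed.
Lemma tensDl a a' b : (a + a') ⊗ b = a ⊗ b + a' ⊗ b.
Proof. by rewrite -[a]scale1r tensPl !scale1r. Qed.
Lemma tensDr a b b' : a ⊗ (b + b') = a ⊗ b + a ⊗ b'.
Proof. by rewrite -[b]scale1r tensPr !scale1r. Qed.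
Lemma tensBl a a' b : (a - a') ⊗ b = a ⊗ b - a' ⊗ b.
Proof. by rewrite tensDl -!scaleN1r tensZl. Qed.
Lemma tensBr a b b' : a ⊗ (b - b') = a ⊗ b - a ⊗ b'.
Proof. by rewrite tensDr -!scaleN1r tensZr. Qed.

Fact tens_scaleAl (a : K) (x y : tensor) : a *: (x * y) = (a *: x) * y.
Proof.
have h0 : tens_mul 0 y = 0 by exact: mul0r y.
by move: (tens_mulPl a x 0 y); rewrite h0 !addr0 => /esym.
Qed.
Fact tens_scaleAr (a : K) (x y : tensor) : a *: (x * y) = x * (a *: y).
Proof.
have h0 : tens_mul x 0 = 0 by exact: mulr0 x.
by move: (tens_mulPr a y 0 x); rewrite h0 !addr0 => /esym.
Qed.

End Tensor.

Notation "a ⊗ b" := (tens a b) (at level 40, left associativity) : ring_scope.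

Definition bracket (A : pzRingType) (x y : A) : A := x * y - y * x.

Definition qbracket (K : fieldType) (A : lalgType K) (q : K) (x y : A) : A :=
  q *: (x * y) - q^-1 *: (y * x).

Section BracketMorphism.
Variables (K : fieldType) (A B : lalgType K) (phi : {lrmorphism A -> B}).
Lemma lrmorph_bracket u v : phi (bracket u v) = bracket (phi u) (phi v).
Proof. by rewrite /bracket linearB /= !rmorphM. Qed.
Lemma lrmorph_qbracket c u v :
  phi (qbracket c u v) = qbracket c (phi u) (phi v).
Proof. by rewrite /qbracket linearB !linearZ /= !rmorphM. Qed.
Lemma lrmorph_comm c (u v u' v' : A) :
  phi (u * v - c *: (u' * v')) = phi u * phi v - c *: (phi u' * phi v').
Proof. by rewrite linearB linearZ /= !rmorphM. Qed.
Lemma lrmorph_inv (u v : A) : phi (u * v - 1) = phi u * phi v - 1.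
Proof. by rewrite linearB /= rmorphM rmorph1. Qed.
Lemma lrmorph_ef (c d : K) (u v u' v' : A) :
  phi (bracket u v - c *: (d *: (u' ^+ 2 - v' ^+ 2))) =
  bracket (phi u) (phi v) - c *: (d *: (phi u' ^+ 2 - phi v' ^+ 2)).
Proof.
rewrite linearB !linearZ /= lrmorph_bracket linearB !rmorphXn /=.
by rewrite !scalerN.
Qed.
End BracketMorphism.

Section QSerre.
Variables (K : fieldType) (A : algType K).
Implicit Types (c p : K) (x y z t : A).

Lemma bracketDl x y z : bracket (x + y) z = bracket x z + bracket y z.
Proof. by rewrite /bracket mulrDl mulrDr opprD addrACA. Qed.
Lemma bracketDr x y z : bracket x (y + z) = bracket x y + bracket x z.
Proof. by rewrite /bracket mulrDl mulrDr opprD addrACA. Qed.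
Lemma qbracketDl c x y z :
  qbracket c (x + y) z = qbracket c x z + qbracket c y z.
Proof. by rewrite /qbracket mulrDl mulrDr !scalerDr opprD addrACA. Qed.
Lemma qbracketDr c x y z :
  qbracket c x (y + z) = qbracket c x y + qbracket c x z.
Proof. by rewrite /qbracket mulrDl mulrDr !scalerDr opprD addrACA. Qed.
Lemma bracket_qbracket x y : bracket x y = qbracket 1 x y.
Proof. by rewrite /qbracket invr1 !scale1r. Qed.

Lemma qbracketC c p x y :
  qbracket c x (qbracket p x y) = qbracket p x (qbracket c x y).
Proof.
rewrite /qbracket !mulrBr !mulrBl -!scalerAr -!scalerAl !scalerBr !scalerA.
rewrite !mulrA !opprB [c * p]mulrC [c^-1 * p^-1]mulrC.
rewrite [p * c^-1]mulrC [p^-1 * c]mulrC -!addrA; congr (_ + _).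
by rewrite addrC addrAC addrC.
Qed.

Definition qserre p x y : A := bracket x (qbracket p^-1 x (qbracket p x y)).

Lemma qserre_sym p x y : qserre p^-1 x y = qserre p x y.
Proof. by rewrite /qserre invrK qbracketC. Qed.

Lemma qserreE p x y : qserre p x y = qbracket p^-1 x (bracket x (qbracket p x y)).
Proof. by rewrite /qserre !bracket_qbracket qbracketC. Qed.

Lemma qserreDr p x y z : qserre p x (y + z) = qserre p x y + qserre p x z.
Proof. by rewrite /qserre !qbracketDr bracketDr. Qed.

Lemma qbracket_eq0 c x y : c != 0 -> x * y = c ^- 2 *: (y * x) ->
  qbracket c x y = 0.
Proof.
move=> c0 h; rewrite /qbracket h scalerA expr2 invfM mulrA divff // mul1r.
exact: subrr.
Qed.

Lemma qcomm_qbracket a b c x y z :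
  z * x = a *: (x * z) -> z * y = b *: (y * z) ->
  z * qbracket c x y = (a * b) *: (qbracket c x y * z).
Proof.
move=> hx hy.
have hxy : z * (x * y) = (a * b) *: (x * y * z).
  by rewrite mulrA hx -scalerAl -[x * z * y]mulrA hy -scalerAr scalerA mulrA.
have hyx : z * (y * x) = (a * b) *: (y * x * z).
  by rewrite mulrA hy -scalerAl -[y * z * x]mulrA hx -scalerAr scalerA mulrA [b * a]mulrC.
rewrite /qbracket mulrBr -!scalerAr hxy hyx mulrBl -!scalerAl scalerBr.
by rewrite !scalerA [_ * c]mulrC [_ * c^-1]mulrC.
Qed.

Lemma qserre_addl p x x' y : p != 0 ->
  y * x = p ^+ 2 *: (x * y) -> y * x' = p ^- 2 *: (x' * y) ->
  qserre p (x + y) x' = qserre p x x'.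
Proof.
move=> p0 hx hx'; rewrite !qserreE.
have p2 : p ^+ 2 * p ^- 2 = 1 by rewrite divff // expf_neq0.
have -> : qbracket p (x + y) x' = qbracket p x x'.
  by rewrite qbracketDl [X in _ + X]qbracket_eq0 ?addr0.
have h1 := qcomm_qbracket p hx hx'; rewrite p2 scale1r in h1.
have -> : bracket (x + y) (qbracket p x x') = bracket x (qbracket p x x').
  by rewrite bracketDl [X in _ + X]/bracket h1 subrr addr0.
have h2 : y * qbracket p x x' = 1 *: (qbracket p x x' * y) by rewrite scale1r.
have := qcomm_qbracket 1 hx h2; rewrite -bracket_qbracket mulr1 => h3.
by rewrite qbracketDl [X in _ + X]qbracket_eq0 ?addr0 ?invr_eq0 // -exprVn invrK.
Qed.

Lemma qserre_add p x x' y y' : p != 0 ->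
  y * x = p ^+ 2 *: (x * y) -> y * x' = p ^- 2 *: (x' * y) ->
  x * y' = p ^+ 2 *: (y' * x) ->
  qserre p x x' = 0 -> qserre p y y' = 0 -> qserre p (x + y) (x' + y') = 0.
Proof.
move=> p0 hyx hyx' hxy' sx sy.
rewrite qserreDr qserre_addl // sx add0r -qserre_sym [x + y]addrC.
rewrite qserre_addl ?qserre_sym // ?invr_eq0 //.
  by rewrite hyx scalerA exprVn mulVf ?scale1r // expf_neq0.
by rewrite hxy' exprVn invrK.
Qed.

Lemma qcommV p k kV x : k * kV = 1 -> kV * k = 1 ->
  k * x = p *: (x * k) -> x * kV = p *: (kV * x).
Proof.
move=> h1 h2 h; have : kV * (k * x) * kV = kV * (p *: (x * k)) * kV by rewrite h.
by rewrite mulrA h2 mul1r -scalerAr -scalerAl -!mulrA h1 mulr1.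
Qed.

End QSerre.


Inductive LU_gen := ge of 'I_2 | gf of 'I_2 | gk of 'I_2 | gkV of 'I_2.

HB.instance Definition _ := gen_eqMixin LU_gen.
HB.instance Definition _ := gen_choiceMixin LU_gen.

Definition cartan (i j : 'I_2) : int := if i == j then 2 else - 2.

Section LoopAlgebra.
Variables (K : fieldType) (q : K).
Local Notation F := {malg K[{fmonom LU_gen}]}.
Local Notation X g := (<< fmu g >> : F).
Local Notation e i := (X (ge i)).
Local Notation f i := (X (gf i)).
Local Notation k i := (X (gk i)).
Local Notation kV i := (X (gkV i)).

(* gkV i stands for k_i^-1; each relation l = r is encoded by l - r *)
Inductive LU_rel : F -> Prop :=
| LU_rel_ke i j :
    LU_rel (k i * e j - q ^ (cartan i j %/ 2)%Z *: (e j * k i))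
| LU_rel_kf i j :
    LU_rel (k i * f j - q ^ (- (cartan i j %/ 2)%Z) *: (f j * k i))
| LU_rel_ef i j :
    LU_rel (bracket (e i) (f j) -
            (i == j)%:R *: ((q - q^-1)^-1 *: (k i ^+ 2 - kV i ^+ 2)))
| LU_rel_kkV i : LU_rel (k i * kV i - 1)
| LU_rel_kVk i : LU_rel (kV i * k i - 1)
| LU_rel_k0k1 : LU_rel (k 0 * k 1 - 1)
| LU_rel_k1k0 : LU_rel (k 1 * k 0 - 1)
| LU_rel_eee i j : i != j ->
    LU_rel (bracket (e i) (qbracket q^-1 (e i) (qbracket q (e i) (e j))))
| LU_rel_fff i j : i != j ->
    LU_rel (bracket (f i) (qbracket q^-1 (f i) (qbracket q (f i) (f j)))).

Section Eval.
Variables (B : algType K) (h : LU_gen -> B).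
Local Notation e i := (h (ge i)).
Local Notation f i := (h (gf i)).
Local Notation k i := (h (gk i)).
Local Notation kV i := (h (gkV i)).

Lemma LU_rel_eval :
  (forall i j, k i * e j = q ^ (cartan i j %/ 2)%Z *: (e j * k i)) ->
  (forall i j, k i * f j = q ^ (- (cartan i j %/ 2)%Z) *: (f j * k i)) ->
  (forall i j, bracket (e i) (f j) =
    (i == j)%:R *: ((q - q^-1)^-1 *: (k i ^+ 2 - kV i ^+ 2))) ->
  (forall i, k i * kV i = 1) -> (forall i, kV i * k i = 1) ->
  k 0 * k 1 = 1 -> k 1 * k 0 = 1 ->
  (forall i j, i != j ->
    bracket (e i) (qbracket q^-1 (e i) (qbracket q (e i) (e j))) = 0) ->
  (forall i j, i != j ->
    bracket (f i) (qbracket q^-1 (f i) (qbracket q (f i) (f j))) = 0) ->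
  forall r, LU_rel r -> free_eval h r = 0.
Proof.
move=> hke hkf hef hkV hVk h01 h10 hee hff r.
case=> [i j|i j|i j|i|i|||i j ij|i j ij].
- by rewrite lrmorph_comm /= !free_evalU hke subrr.
- by rewrite lrmorph_comm /= !free_evalU hkf subrr.
- by rewrite lrmorph_ef /= !free_evalU hef subrr.
- by rewrite lrmorph_inv /= !free_evalU hkV subrr.
- by rewrite lrmorph_inv /= !free_evalU hVk subrr.
- by rewrite lrmorph_inv /= !free_evalU h01 subrr.
- by rewrite lrmorph_inv /= !free_evalU h10 subrr.
- by rewrite lrmorph_bracket !lrmorph_qbracket /= !free_evalU hee.
- by rewrite lrmorph_bracket !lrmorph_qbracket /= !free_evalU hff.
Qed.
End Eval.

Definition LU := presented LU_rel.

HB.instance Definition _ := GRing.PzRing.on LU.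
HB.instance Definition _ := GRing.Lmodule.on LU.

Definition counit_gen (g : LU_gen) : K^o :=
  match g with ge _ | gf _ => 0 | gk _ | gkV _ => 1 end.

Fact counit_rel r : LU_rel r -> free_eval counit_gen r = 0.
Proof.
by apply: LU_rel_eval => * /=; rewrite /bracket /qbracket;
  rewrite ?(mulr0, mul0r, mulr1, expr1n, subrr, scaler0).
Qed.

Definition counit : LU -> K^o := pres_lift counit_rel.
HB.instance Definition _ := GRing.RMorphism.copy counit (pres_lift counit_rel).
HB.instance Definition _ := GRing.Linear.copy counit (pres_lift counit_rel).

Fact LU_oner_neq0 : (1 : LU) != 0.
Proof.
apply/eqP => /(congr1 counit); rewrite rmorph1 linear0.
by apply/eqP/oner_neq0.
Qed.
HB.instance Definition _ := GRing.PzSemiRing_isNonZero.Build LU LU_oner_neq0.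
HB.instance Definition _ := GRing.Lmodule_isLalgebra.Build K LU
  (@pres_scaleAl _ _ LU_rel).
HB.instance Definition _ := GRing.Lalgebra_isAlgebra.Build K LU
  (@pres_scaleAr _ _ LU_rel).

Definition LU_e : 'I_2 -> LU :=
  locked_with LU_e_key (fun i => pres_pi LU_rel (e i)).
Definition LU_f : 'I_2 -> LU :=
  locked_with LU_f_key (fun i => pres_pi LU_rel (f i)).
Definition LU_k : 'I_2 -> LU :=
  locked_with LU_k_key (fun i => pres_pi LU_rel (k i)).
Definition LU_kV : 'I_2 -> LU :=
  locked_with LU_kV_key (fun i => pres_pi LU_rel (kV i)).

End LoopAlgebra.

Section LoopAlgebraTheory.
Variables (K : fieldType) (q : K).
Local Notation F := {malg K[{fmonom LU_gen}]}.
Local Notation X g := (<< fmu g >> : F).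
Local Notation U := (LU q).
Local Notation e := (LU_e q).
Local Notation f := (LU_f q).
Local Notation k := (LU_k q).
Local Notation kV := (LU_kV q).

Definition LU_pi : F -> U := pres_pi (LU_rel q).
HB.instance Definition _ := GRing.RMorphism.copy LU_pi (pres_pi (LU_rel q)).
HB.instance Definition _ := GRing.Linear.copy LU_pi (pres_pi (LU_rel q)).

Lemma LU_eE i : e i = LU_pi (X (ge i)). Proof. by rewrite /LU_e unlock. Qed.
Lemma LU_fE i : f i = LU_pi (X (gf i)). Proof. by rewrite /LU_f unlock. Qed.
Lemma LU_kE i : k i = LU_pi (X (gk i)). Proof. by rewrite /LU_k unlock. Qed.
Lemma LU_kVE i : kV i = LU_pi (X (gkV i)). Proof. by rewrite /LU_kV unlock. Qed.

Lemma LU_pi0 r : LU_rel q r -> LU_pi r = 0.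
Proof.
move=> h; rewrite -(linear0 LU_pi); apply/pres_piP; rewrite subr0.
exact: ideal_span_rel.
Qed.

Lemma LU_ke i j : k i * e j = q ^ (cartan i j %/ 2)%Z *: (e j * k i).
Proof.
apply: subr0_eq; rewrite LU_eE LU_kE -lrmorph_comm.
exact/LU_pi0/LU_rel_ke.
Qed.
Lemma LU_kf i j : k i * f j = q ^ (- (cartan i j %/ 2)%Z) *: (f j * k i).
Proof.
apply: subr0_eq; rewrite LU_fE LU_kE -lrmorph_comm.
exact/LU_pi0/LU_rel_kf.
Qed.
Lemma LU_ef i j : bracket (e i) (f j) =
  (i == j)%:R *: ((q - q^-1)^-1 *: (k i ^+ 2 - kV i ^+ 2)).
Proof.
apply: subr0_eq; rewrite LU_eE LU_fE LU_kE LU_kVE -lrmorph_ef.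
exact/LU_pi0/LU_rel_ef.
Qed.
Lemma LU_kkV i : k i * kV i = 1.
Proof.
by apply: subr0_eq; rewrite LU_kE LU_kVE -lrmorph_inv; apply/LU_pi0/LU_rel_kkV.
Qed.
Lemma LU_kVk i : kV i * k i = 1.
Proof.
by apply: subr0_eq; rewrite LU_kE LU_kVE -lrmorph_inv; apply/LU_pi0/LU_rel_kVk.
Qed.
Lemma LU_k0k1 : k 0 * k 1 = 1.
Proof.
by apply: subr0_eq; rewrite !LU_kE -lrmorph_inv; apply/LU_pi0/LU_rel_k0k1.
Qed.
Lemma LU_k1k0 : k 1 * k 0 = 1.
Proof.
by apply: subr0_eq; rewrite !LU_kE -lrmorph_inv; apply/LU_pi0/LU_rel_k1k0.
Qed.
Lemma LU_eee i j : i != j -> qserre q (e i) (e j) = 0.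
Proof.
move=> ij; rewrite /qserre !LU_eE -!lrmorph_qbracket -lrmorph_bracket.
exact/LU_pi0/LU_rel_eee.
Qed.
Lemma LU_fff i j : i != j -> qserre q (f i) (f j) = 0.
Proof.
move=> ij; rewrite /qserre !LU_fE -!lrmorph_qbracket -lrmorph_bracket.
exact/LU_pi0/LU_rel_fff.
Qed.

Lemma ord2P (i : 'I_2) : i = 0 \/ i = 1.
Proof. by case: i => [[|[|//]] h]; [left|right]; apply: val_inj. Qed.

Lemma LU_kC i j : k i * k j = k j * k i.
Proof.
by case: (ord2P i) => ->; case: (ord2P j) => ->; rewrite ?LU_k0k1 ?LU_k1k0.
Qed.
Lemma LU_kkVC i j : k i * kV j = kV j * k i.
Proof.
have := @qcommV _ _ 1 (k j) (kV j) (k i); rewrite !scale1r => -> //.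
- exact: LU_kkV.
- exact: LU_kVk.
- exact: LU_kC.
Qed.
Lemma LU_kVC i j : kV i * kV j = kV j * kV i.
Proof.
have := @qcommV _ _ 1 (k j) (kV j) (kV i); rewrite !scale1r => -> //.
- exact: LU_kkV.
- exact: LU_kVk.
- exact: LU_kkVC.
Qed.

Lemma LU_ekV i j : e j * kV i = q ^ (cartan i j %/ 2)%Z *: (kV i * e j).
Proof. by apply: (qcommV (LU_kkV i) (LU_kVk i)); apply: LU_ke. Qed.
Lemma LU_fkV i j : f j * kV i = q ^ (- (cartan i j %/ 2)%Z) *: (kV i * f j).
Proof. by apply: (qcommV (LU_kkV i) (LU_kVk i)); apply: LU_kf. Qed.

Definition LU2 := tensor (LU q) (LU q).
HB.instance Definition _ := GRing.PzRing.on LU2.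
HB.instance Definition _ := GRing.Lmodule.on LU2.

Fact LU2_oner_neq0 : (1 : LU2) != 0.
Proof.
pose m (a b : U) : K^o := counit a * counit b.
have hm : bilinear2 m.
  split=> [b|a] c u v; rewrite /m linearP /=.
    by rewrite mulrDl scalerAl.
  by rewrite mulrDr scalerAr.
apply/eqP => /(congr1 (tens_lift m)).
rewrite (tens_liftE hm) /m !rmorph1 mulr1.
have := tens_lift_linear hm (-1) 0 0; rewrite scaler0 addr0 scaleN1r addNr => ->.
by apply/eqP/oner_neq0.
Qed.
HB.instance Definition _ := GRing.PzSemiRing_isNonZero.Build LU2 LU2_oner_neq0.
HB.instance Definition _ := GRing.Lmodule_isLalgebra.Build K LU2
  (@tens_scaleAl K U U).
HB.instance Definition _ := GRing.Lalgebra_isAlgebra.Build K LU2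
  (@tens_scaleAr K U U).


Implicit Types (a b : U).
Local Notation "a ⊗ b" := (tens a b : LU2) : ring_scope.

Lemma tens_qbracketl c a a' b b' : b * b' = b' * b ->
  qbracket c (a ⊗ b) (a' ⊗ b') = qbracket c a a' ⊗ (b * b').
Proof. by move=> h; rewrite /qbracket !tensM -h tensBl !tensZl. Qed.
Lemma tens_qbracketr c a a' b b' : a * a' = a' * a ->
  qbracket c (a ⊗ b) (a' ⊗ b') = (a * a') ⊗ qbracket c b b'.
Proof. by move=> h; rewrite /qbracket !tensM -h tensBr !tensZr. Qed.

Lemma tens_qserrel p a a' b b' : b * b' = b' * b ->
  qserre p (a ⊗ b) (a' ⊗ b') = qserre p a a' ⊗ (b * (b * (b * b'))).
Proof.
move=> h; have h1 : b * (b * b') = b * b' * b by rewrite h mulrA h.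
have h2 : b * (b * (b * b')) = b * (b * b') * b by rewrite h1 mulrA h1.
rewrite /qserre !bracket_qbracket.
by rewrite tens_qbracketl // tens_qbracketl // tens_qbracketl.
Qed.
Lemma tens_qserrer p a a' b b' : a * a' = a' * a ->
  qserre p (a ⊗ b) (a' ⊗ b') = (a * (a * (a * a'))) ⊗ qserre p b b'.
Proof.
move=> h; have h1 : a * (a * a') = a * a' * a by rewrite h mulrA h.
have h2 : a * (a * (a * a')) = a * (a * a') * a by rewrite h1 mulrA h1.
rewrite /qserre !bracket_qbracket.
by rewrite tens_qbracketr // tens_qbracketr // tens_qbracketr.
Qed.

Lemma Delta_serre p (x : 'I_2 -> U) i j : p != 0 ->
  k i * x i = p *: (x i * k i) -> k j * x j = p *: (x j * k j) ->
  k i * x j = p^-1 *: (x j * k i) -> k j * x i = p^-1 *: (x i * k j) ->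
  qserre p (x i) (x j) = 0 ->
  qserre p (x i ⊗ kV i + k i ⊗ x i) (x j ⊗ kV j + k j ⊗ x j) = 0.
Proof.
move=> p0 hii hjj hij hji sx.
have vii := qcommV (LU_kkV i) (LU_kVk i) hii.
have vji := qcommV (LU_kkV j) (LU_kVk j) hji.
have vij := qcommV (LU_kkV i) (LU_kVk i) hij.
apply: qserre_add => //.
- by rewrite !tensM hii vii tensZl tensZr scalerA.
- by rewrite !tensM hij vji tensZl tensZr scalerA -invfM.
- rewrite !tensM hji tensZl vij tensZr !scalerA expr2.
  by rewrite mulrA mulfK // divff // scale1r.
- by rewrite tens_qserrel ?sx ?tens0l //; apply: LU_kVC.
- by rewrite tens_qserrer ?sx ?tens0r //; apply: LU_kC.
Qed.

Definition Delta_gen (g : LU_gen) : LU2 :=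
  match g with
  | ge i => e i ⊗ kV i + k i ⊗ e i
  | gf i => f i ⊗ kV i + k i ⊗ f i
  | gk i => k i ⊗ k i
  | gkV i => kV i ⊗ kV i
  end.

Lemma cartanC i j : cartan i j = cartan j i.
Proof. by rewrite /cartan eq_sym. Qed.

Lemma cartan_ii i : (cartan i i %/ 2)%Z = 1.
Proof. by rewrite /cartan eqxx. Qed.
Lemma cartan_ij i j : i != j -> (cartan i j %/ 2)%Z = -1.
Proof. by rewrite /cartan => /negPf ->. Qed.

Lemma Delta_kx (z : int) (x : 'I_2 -> U) i j : k i * x j = q ^ z *: (x j * k i) ->
  (k i ⊗ k i) * (x j ⊗ kV j + k j ⊗ x j) =
  q ^ z *: ((x j ⊗ kV j + k j ⊗ x j) * (k i ⊗ k i)).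
Proof.
move=> h; rewrite mulrDr mulrDl !tensM h tensZl tensZr LU_kkVC LU_kC.
by rewrite scalerDr.
Qed.

Lemma Delta_ef i j : q != 0 ->
  bracket (e i ⊗ kV i + k i ⊗ e i) (f j ⊗ kV j + k j ⊗ f j) =
  (i == j)%:R *: ((q - q^-1)^-1 *:
    ((k i ⊗ k i) ^+ 2 - (kV i ⊗ kV i) ^+ 2)).
Proof.
move=> q0; rewrite bracketDl !bracketDr.
have qq z : q ^ z * q ^ (- z) = 1 by rewrite -invr_expz divff // expfz_neq0.
have -> : bracket (e i ⊗ kV i) (k j ⊗ f j) = 0.
  rewrite /bracket !tensM LU_ke LU_fkV tensZl tensZr scalerA cartanC qq.
  by rewrite scale1r subrr.
have -> : bracket (k i ⊗ e i) (f j ⊗ kV j) = 0.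
  rewrite /bracket !tensM LU_kf LU_ekV tensZl tensZr scalerA cartanC mulrC qq.
  by rewrite scale1r subrr.
rewrite addr0 add0r !bracket_qbracket tens_qbracketl; last exact: LU_kVC.
rewrite tens_qbracketr; last exact: LU_kC.
rewrite -!bracket_qbracket !LU_ef; case: eqVneq => [<-|_].
  rewrite !scale1r tensZl tensZr -scalerDr; congr (_ *: _).
  by rewrite !expr2 !tensM tensBl tensBr addrC subrKA.
by rewrite !scale0r tens0l tens0r addr0.
Qed.

Lemma LU_e0 i : q = 0 -> e i = 0.
Proof.
move=> q0; rewrite -[e i]mul1r -(LU_kVk i) -mulrA LU_ke cartan_ii q0.
by rewrite scale0r mulr0.
Qed.
Lemma LU_f0 i : q = 0 -> f i = 0.
Proof.
move=> q0; rewrite -[f i]mul1r -(LU_kVk i) -mulrA LU_kf cartan_ii q0.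
by rewrite exprN1 invr0 scale0r mulr0.
Qed.

Fact Delta_rel r : LU_rel q r -> free_eval Delta_gen r = 0.
Proof.
apply: LU_rel_eval => /= [i j|i j|i j|i|i|||i j ij|i j ij].
- exact/Delta_kx/LU_ke.
- exact/Delta_kx/LU_kf.
- have [q0|q0] := eqVneq q 0; last exact: Delta_ef.
  rewrite !LU_e0 // !LU_f0 // !tens0l !tens0r !addr0 /bracket mulr0 subrr.
  have -> : (q - q^-1)^-1 = 0 by rewrite q0 invr0 subrr invr0.
  by rewrite scale0r scaler0.
- by rewrite tensM LU_kkV.
- by rewrite tensM LU_kVk.
- by rewrite tensM LU_k0k1.
- by rewrite tensM LU_k1k0.
- have [q0|q0] := eqVneq q 0.
    by rewrite LU_e0 // tens0l tens0r addr0 /bracket mul0r mulr0 subrr.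
  apply: Delta_serre => //; last exact: LU_eee.
  + by rewrite LU_ke cartan_ii.
  + by rewrite LU_ke cartan_ii.
  + by rewrite LU_ke cartan_ij // exprN1.
  + by rewrite LU_ke cartan_ij // 1?eq_sym // exprN1.
- have [q0|q0] := eqVneq q 0.
    by rewrite LU_f0 // tens0l tens0r addr0 /bracket mul0r mulr0 subrr.
  rewrite -/(qserre _ _ _) -qserre_sym.
  apply: Delta_serre; rewrite ?invr_eq0 //; last by rewrite qserre_sym LU_fff.
  + by rewrite LU_kf cartan_ii exprN1.
  + by rewrite LU_kf cartan_ii exprN1.
  + by rewrite LU_kf cartan_ij // opprK invrK.
  + by rewrite LU_kf cartan_ij // 1?eq_sym // opprK invrK.
Qed.

(* No hypothesis on q is needed: if q = 0 then 0^-1 = 0 makes e_i = f_i = 0 *)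
Definition Delta : U -> LU2 := pres_lift Delta_rel.
HB.instance Definition _ := GRing.RMorphism.copy Delta (pres_lift Delta_rel).
HB.instance Definition _ := GRing.Linear.copy Delta (pres_lift Delta_rel).

Lemma Delta_e i : Delta (e i) = e i ⊗ kV i + k i ⊗ e i.
Proof. by rewrite [in LHS]LU_eE [LHS]pres_lift_pi free_evalU. Qed.
Lemma Delta_f i : Delta (f i) = f i ⊗ kV i + k i ⊗ f i.
Proof. by rewrite [in LHS]LU_fE [LHS]pres_lift_pi free_evalU. Qed.
Lemma Delta_k i : Delta (k i) = k i ⊗ k i.
Proof. by rewrite [in LHS]LU_kE [LHS]pres_lift_pi free_evalU. Qed.
Lemma Delta_kV i : Delta (kV i) = kV i ⊗ kV i.
Proof. by rewrite [in LHS]LU_kVE [LHS]pres_lift_pi free_evalU. Qed.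

Definition flip : LU2 -> LU2 := tens_lift (fun a b => b ⊗ a).

Fact flip_bilin : bilinear2 (fun a b => b ⊗ a).
Proof. by split=> [b|a] c u v; rewrite ?tensPl ?tensPr. Qed.

Fact flip_linear : linear flip.
Proof. exact: tens_lift_linear flip_bilin. Qed.
HB.instance Definition _ := GRing.isLinear.Build K LU2 LU2 *:%R flip flip_linear.

Lemma flipE a b : flip (a ⊗ b) = b ⊗ a.
Proof. exact: tens_liftE flip_bilin a b. Qed.

Definition Delta_op (x : U) : LU2 := flip (Delta x).

Definition Ahat (alpha : K) : U :=
  (q - q^-1) *: (e 1 * k 1 - f 1 * k 1) + alpha *: k 1 ^+ 2.

Definition Bhat (beta : K) : U :=
  (q - q^-1) *: (f 0 * k 0 - e 0 * k 0) + beta *: k 0 ^+ 2.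

End LoopAlgebraTheory.

(* The subalgebra generated by S: the intersection of all those containing S *)
Definition generated_subalg (K : fieldType) (A : lalgType K) (S : A -> Prop)
    (u : A) : Prop :=
  forall P : {pred A},
    GRing.subalg_closed P -> (forall s, S s -> s \in P) -> u \in P.

Definition generates_commutative (K : fieldType) (A : lalgType K) (x y : A) :=
  forall u v, generated_subalg (fun s => s = x \/ s = y) u ->
    generated_subalg (fun s => s = x \/ s = y) v -> u * v = v * u.

(* Main.v *)
(** Writing [A = Y + alpha k^2] with [Y = (q - q^-1)(e k - f k)] (indices 1),
    one finds [Delta A = Y ⊗ 1 + k^2 ⊗ A]; both summands visibly commute with
    [1 ⊗ A]. The same holds for [B] with indices 0, and flipping the factors gives
    the opposite coproduct. *)
Require Import Defs.
From HB Require Import structures.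
From mathcomp Require Import all_boot all_order all_algebra.
From mathcomp Require Import boolp reals complex finmap monalg.

Set Implicit Arguments.
Unset Strict Implicit.
Unset Printing Implicit Defensive.

Import Order.TTheory GRing.Theory Num.Theory.
Local Open Scope ring_scope.

(** Each centralizer [C s] is a subalgebra, so an [s] commuting with [x] and [y] commutes with all
    they generate. *)
Lemma generates_commutative_comm (K : fieldType) (A : algType K) (x y : A) :
  x * y = y * x -> generates_commutative x y.
Proof.
move=> xy u v gu gv.
pose C (s : A) : {pred A} := fun t => `[< t * s = s * t >].
have C_closed s : GRing.subalg_closed (C s).
  split=> [|a t t' /asboolP ht /asboolP ht'|t t' /asboolP ht /asboolP ht'];
    apply/asboolP; first by rewrite mul1r mulr1.
  - by rewrite mulrDl mulrDr -scalerAl -scalerAr ht ht'.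
  - by rewrite -mulrA ht' mulrA ht mulrA.
have comm_gen s w : s * x = x * s -> s * y = y * s ->
    generated_subalg (fun t => t = x \/ t = y) w -> s * w = w * s.
  move=> sx sy /(_ (C s) (C_closed s)) h; apply/esym/asboolP/h.
  by move=> t [] ->; apply/asboolP.
(* Two passes: [s := x] and [s := y] show that [u] commutes with both generators; then [s := u]
   reaches [v]. *)
by apply: (comm_gen u v) gv; apply/esym; apply: (comm_gen _ u) gu.
Qed.

Section Coideal.
Variables (K : fieldType) (q : K).
Implicit Types (a b x y : LU q).

Lemma tens_comm1 a b : (a ⊗ 1) * (1 ⊗ b) = (1 ⊗ b) * (a ⊗ 1) :> LU2 q.
Proof. by rewrite !tensM !mul1r !mulr1. Qed.

(** Both products equal [y ⊗ x + b ⊗ x ^+ 2]. *)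
Lemma comm_1tens x y b :
  (1 ⊗ x) * (y ⊗ 1 + b ⊗ x) = (y ⊗ 1 + b ⊗ x) * (1 ⊗ x) :> LU2 q.
Proof. by rewrite mulrDl mulrDr !tensM !mul1r !mulr1. Qed.

Lemma comm_tens1 x y b :
  (x ⊗ 1) * (1 ⊗ y + x ⊗ b) = (1 ⊗ y + x ⊗ b) * (x ⊗ 1) :> LU2 q.
Proof. by rewrite mulrDl mulrDr !tensM !mul1r !mulr1. Qed.

(** The right factor [k_i] cancels the [k_i^-1] in the coproduct of [e_i], leaving 1 in the second
    slot. *)
Lemma Delta_ek i :
  Delta (LU_e q i * LU_k q i) =
  (LU_e q i * LU_k q i) ⊗ 1 + (LU_k q i ^+ 2) ⊗ (LU_e q i * LU_k q i).
Proof. by rewrite rmorphM /= Delta_e Delta_k mulrDl !tensM LU_kVk. Qed.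

Lemma Delta_fk i :
  Delta (LU_f q i * LU_k q i) =
  (LU_f q i * LU_k q i) ⊗ 1 + (LU_k q i ^+ 2) ⊗ (LU_f q i * LU_k q i).
Proof. by rewrite rmorphM /= Delta_f Delta_k mulrDl !tensM LU_kVk. Qed.

Lemma Delta_k2 i :
  Delta (LU_k q i ^+ 2) = (LU_k q i ^+ 2) ⊗ (LU_k q i ^+ 2).
Proof. by rewrite rmorphXn /= Delta_k expr2 tensM. Qed.

(** The condition on [x] and [y] is linear. Since [k_i^2] is group-like, the [d] term is absorbed
    into the summand with left factor [k_i^2] and adds nothing to the one of the form [_ ⊗ 1]. *)
Lemma Delta_coideal c d i x y :
  Delta x = x ⊗ 1 + (LU_k q i ^+ 2) ⊗ x ->
  Delta y = y ⊗ 1 + (LU_k q i ^+ 2) ⊗ y ->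
  Delta (c *: (x - y) + d *: LU_k q i ^+ 2) =
  (c *: (x - y)) ⊗ 1 + (LU_k q i ^+ 2) ⊗ (c *: (x - y) + d *: LU_k q i ^+ 2).
Proof.
move=> hx hy; rewrite linearD !linearZ linearB /= hx hy Delta_k2.
rewrite tensDr !tensZr tensZl tensBl tensBr opprD addrACA.
by rewrite (scalerDr c (x ⊗ 1 - _)) addrA.
Qed.

Lemma Delta_Ahat alpha :
  Delta (Ahat q alpha) = ((q - q^-1) *: (LU_e q 1 * LU_k q 1 - LU_f q 1 * LU_k q 1)) ⊗ 1
    + (LU_k q 1 ^+ 2) ⊗ Ahat q alpha.
Proof. exact: Delta_coideal (Delta_ek 1) (Delta_fk 1). Qed.

Lemma Delta_Bhat beta :
  Delta (Bhat q beta) = ((q - q^-1) *: (LU_f q 0 * LU_k q 0 - LU_e q 0 * LU_k q 0)) ⊗ 1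
    + (LU_k q 0 ^+ 2) ⊗ Bhat q beta.
Proof. exact: Delta_coideal (Delta_fk 0) (Delta_ek 0). Qed.

(** The flip gives [1 ⊗ y + x ⊗ b], the mirror image of the case of [1 ⊗ x]. *)
Lemma Delta_op_comm x y b :
  Delta x = y ⊗ 1 + b ⊗ x ->
  (x ⊗ 1) * Delta_op x = Delta_op x * (x ⊗ 1) :> LU2 q.
Proof.
by move=> h; rewrite /Delta_op h linearD /= !flipE; apply: comm_tens1.
Qed.

End Coideal.

Theorem proposition3p3 (R : realType) (q alpha beta : R[i])
    (q_neq0 : q != 0)
    (q_not_root_of_unity : forall n : nat, (0 < n)%N -> q ^+ n != 1) :
  generates_commutative (1 ⊗ Ahat q alpha : LU2 q) (Delta (Ahat q alpha)) /\
  generates_commutative (Ahat q alpha ⊗ 1 : LU2 q) (Delta_op (Ahat q alpha)) /\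
  generates_commutative (1 ⊗ Bhat q beta : LU2 q) (Delta (Bhat q beta)) /\
  generates_commutative (Bhat q beta ⊗ 1 : LU2 q) (Delta_op (Bhat q beta)) /\
  generates_commutative (Ahat q alpha ⊗ 1 : LU2 q) (1 ⊗ Bhat q beta : LU2 q) /\
  generates_commutative (Bhat q beta ⊗ 1 : LU2 q) (1 ⊗ Ahat q alpha : LU2 q).
Proof.
do ! split; apply: generates_commutative_comm.
- by rewrite Delta_Ahat; apply: comm_1tens.
- exact: Delta_op_comm (Delta_Ahat q alpha).
- by rewrite Delta_Bhat; apply: comm_1tens.
- exact: Delta_op_comm (Delta_Bhat q beta).
(* In the last two pairs the elements lie in different tensor factors. *)
- exact: tens_comm1.
- exact: tens_comm1.
Qed.
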